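(* Let $0<p<1$, $0<r<1$ and $0<\lambda\le 1$. For a network with Bernoulli packet arrivals at rate $\lambda$ over the Gilbert-Elliott erasure channel $GE(p,r)$, the average age of information under the preemptive last-generated-first-served (pLGFS) policy is $$\bar\Delta_{BL}=\frac{1}{\lambda}+\frac{p}{r(p+r)}.$$
   Context: Time is slotted, $t=1,2,\dots$. Packets are generated (equivalently, arrive at the transmitter) at the beginning of a slot. At most one packet is transmitted per slot; a packet transmitted in slot $t$ and not erased is received at the end of slot $t$, i.e. is available at the receiver at the beginning of slot $t+1$. A packet may be transmitted in the same slot in which it is generated. Channel $GE(p,r)$: the channel state is a two-state Markov chain on $\{G,B\}$ (one step per slot) with transition probability $p$ from $G$ to $B$ and $r$ from $B$ to $G$. A transmission in a slot with state $G$ always succeeds (erasure probability $0$), and in a slot with state $B$ always fails (erasure probability $1$). Bernoulli arrival at rate $\lambda$: in each slot a new packet arrives with probability $\lambda$ and no packet arrives with probability $1-\lambda$, independently over slots and independently of the channel. pLGFS policy: the transmitter holds a single packet; the latest generated packet is transmitted repeatedly, slot after slot, until it is either successfully delivered or preempted (replaced) by the next arriving packet. Age of information (AoI): at the beginning of slot $t$, $\Delta_t=t-u_t$, where $u_t$ is the generation slot of the latest (most recently generated) packet received by the beginning of slot $t$. The average AoI is the long-run time average $\lim_{\tau\to\infty}\frac1\tau\sum_{t=1}^{\tau}\Delta_t$ (almost surely; the value assigned before the first delivery is irrelevant). *)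

(* Defs.v *)
From HB Require Import structures.
From mathcomp Require Import all_boot all_order all_algebra.
From mathcomp Require Import all_classical all_reals all_analysis.
Import numFieldNormedType.Exports.

Set Implicit Arguments.
Unset Strict Implicit.
Unset Printing Implicit Defensive.

Import Order.TTheory GRing.Theory Num.Theory.
Local Open Scope classical_set_scope.
Local Open Scope ring_scope.

(* Slots are numbered 1, 2, ...  Processes are indexed by nat, and index 0 is
   unused: no assumption constrains it and nothing below reads it. *)

(* Channel states: true is G (every transmission succeeds), false is B (every
   transmission is erased). *)
Definition GE_trans (R : realType) (p r : R) (x y : bool) : R :=
  match x, y with
  | true, false => p
  | true, true => 1 - p
  | false, true => r
  | false, false => 1 - r
  end.

Section probability.
Context {d : measure_display} {T : measurableType d} {R : realType}.
Variable P : probability T R.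

Definition cond_prob (E F : set T) : R := fine (P (E `&` F)) / fine (P F).

Definition history (S : nat -> {RV P >-> bool}) (c : nat -> bool) (n : nat)
  : set T := [set w | forall t, (0 < t <= n)%N -> S t w = c t].

(* The Markov property together with the transition matrix; the distribution
   of the initial state S 1 is arbitrary. *)
Definition GE_channel (p r : R) (S : nat -> {RV P >-> bool}) : Prop :=
  forall (c : nat -> bool) (n : nat), (0 < n)%N ->
    P (history S c n) != 0%E ->
    cond_prob (S n.+1 @^-1` [set c n.+1]) (history S c n)
      = GE_trans p r (c n) (c n.+1).

Definition mutually_independent (X : nat -> {RV P >-> bool}) : Prop :=
  forall (J : seq nat) (B : nat -> set bool),
    uniq J -> all (fun t => 0 < t)%N J ->
    P (\bigcap_(t in [set` J]) X t @^-1` B t)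
      = (\prod_(t <- J) P (X t @^-1` B t))%E.

(* A t w holds when a packet is generated in slot t. *)
Definition bernoulli_arrivals (lam : R) (A : nat -> {RV P >-> bool}) : Prop :=
  (forall t, (0 < t)%N -> P (A t @^-1` [set true]) = lam%:E) /\
  mutually_independent A.

Definition sigma_process (X : nat -> {RV P >-> bool}) : set (set T) :=
  <<s \bigcup_(t in [set t | (0 < t)%N]) g_sigma_algebra_preimage (X t) >>.

Definition independent_processes (X Y : nat -> {RV P >-> bool}) : Prop :=
  forall E F : set T, sigma_process X E -> sigma_process Y F ->
    P (E `&` F) = (P E * P F)%E.

End probability.

(* A packet is identified with its generation slot; None means no packet. *)
Section policy.
Variables a s : nat -> bool. (* arrivals and channel states along one path *)

(* The packet transmitted in slot t, if b is held just before slot t: a packet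
   generated in slot t preempts b and is transmitted at once. *)
Definition preempt (b : option nat) (t : nat) : option nat :=
  if a t then Some t else b.

(* The packet still held by the transmitter at the end of slot t. *)
Fixpoint held (t : nat) : option nat :=
  match t with
  | 0 => None
  | t'.+1 => if s t then None else preempt (held t') t
  end.

Definition transmitted (t : nat) : option nat := preempt (held t.-1) t.

Definition delivered (t : nat) : option nat :=
  if s t then transmitted t else None.

(* The packets received by the beginning of slot t, i.e. those delivered in
   slots 1, ..., t - 1. *)
Definition received (t : nat) : seq nat := pmap delivered (iota 1 t.-1).

(* dflt is the value given to the age before the first delivery. *)
Definition age (R : realType) (dflt : nat -> R) (t : nat) : R :=
  if received t is [::] then dflt t
  else t%:R - (\max_(u <- received t) u)%N%:R.

Definition time_average (R : realType) (x : nat -> R) (tau : nat) : R :=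
  tau%:R^-1 * \sum_(1 <= t < tau.+1) x t.

End policy.

(* Main.v *)
(* At the end of every slot the age is 1 more than before if the channel is bad,
   and equals the age of the newest generated packet if it is good. Together
   with the channel state, the source age and the product of these two, the age
   therefore has a closed linear one-step drift, so an explicit corrector solves
   the Poisson equation: the centered partial sums of the age are a martingale
   plus a bounded-in-L^2 error. The increments are bounded in L^2, hence the
   centered sum up to n has second moment O(n), and the averages along n = k^2
   converge almost surely because the sum of 1/k^2 is finite. Since ages are
   nonnegative, monotonicity of the partial sums fills in the times between
   squares. *)

Require Import Defs.
From HB Require Import structures.
From mathcomp Require Import all_boot all_order all_algebra.
From mathcomp Require Import all_classical all_reals all_analysis.
From mathcomp Require Import measurable_realfun ring lra.
Import numFieldNormedType.Exports.
Import Order.TTheory GRing.Theory Num.Theory.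
Local Open Scope classical_set_scope.
Local Open Scope ring_scope.

Set Implicit Arguments.
Unset Strict Implicit.
Unset Printing Implicit Defensive.

(** * Ages along one path, as functions of the list of past slots *)

Section deterministic.
Variable R : realType.

(* Newest slot first, as (channel state, arrival) pairs. *)
Fixpoint trace (c : nat -> bool * bool) (n : nat) : seq (bool * bool) :=
  if n is n'.+1 then c n :: trace c n' else [::].

(* Ages at the beginning of the slot after the trace. Before the first arrival,
   resp. delivery, a fictitious packet of slot 0 counts as generated, resp.
   received, so that the ages obey their recursions from the start. *)
Fixpoint source_age (l : seq (bool * bool)) : R :=
  if l is x :: l' then if x.2 then 1 else source_age l' + 1 else 1.

Fixpoint trace_age (l : seq (bool * bool)) : R :=
  if l is x :: l' then if x.1 then source_age l else trace_age l' + 1 else 1.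

Lemma source_age_ge1 l : 1 <= source_age l.
Proof. by elim: l => //= x l ih; case: ifP => // _; lra. Qed.

Lemma trace_age_ge1 l : 1 <= trace_age l.
Proof.
elim: l => //= x l ih; have h := source_age_ge1 l.
by case: (x.1); case: (x.2) => //; lra.
Qed.

(** The value 0 before the first arrival is the fictitious packet of slot 0; it agrees with the
    maximum over an empty list of received packets. *)
Fixpoint last_arrival (a : nat -> bool) (n : nat) : nat :=
  if n is n'.+1 then if a n then n else last_arrival a n' else 0.

Lemma last_arrival_le a n : (last_arrival a n <= n)%N.
Proof. by elim: n => //= n ih; case: ifP => // _; exact: leqW. Qed.

Lemma received_recr a s t :
  received a s t.+2 = received a s t.+1 ++ seq_of_opt (delivered a s t.+1).
Proof.
have -> : received a s t.+2 = pmap (delivered a s) (iota 1 t ++ [:: t.+1]).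
  by rewrite -(iotaD 1 t 1) addn1.
by rewrite pmap_cat.
Qed.

(** Invariant of the policy: a held packet is always the newest one, and when none is held the
    newest has been received. The inequality makes the induction work: once the newest packet is
    delivered, it is the new maximum. *)
Lemma freshest_received a s t :
  let m := (\max_(u <- received a s t.+1) u)%N in
  (m <= last_arrival a t)%N /\
  (if held a s t is Some v then v = last_arrival a t else m = last_arrival a t).
Proof.
elim: t => [|t]; first by rewrite /= /received /= big_nil.
rewrite received_recr big_cat /= /delivered /transmitted /= => -[].
set m := (\big[_/_]_(u <- received _ _ _) u)%N.
have hle := last_arrival_le a t.
rewrite /preempt /=; case: (a t.+1) => /= [hm _|].
  have hm' : (m <= t.+1)%N by apply: leq_trans hm _; apply: leqW.
  case: (s t.+1) => /=; rewrite ?big_seq1 ?big_nil ?maxn0 //.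
  by rewrite (maxn_idPr hm').
by case: (held a s t) => [v|] hm hv; case: (s t.+1) => /=;
  rewrite ?big_seq1 ?big_nil ?maxn0 ?hv ?(maxn_idPr hm).
Qed.

Lemma source_age_trace a s t :
  source_age (trace (fun i => (s i, a i)) t)
    = t.+1%:R - (last_arrival a t)%:R.
Proof.
elim: t => [|t ih] /=; first by rewrite subr0.
case: (a t.+1); first by rewrite -natrB ?subSnn.
by rewrite ih -[t.+2]addn1 natrD; lra.
Qed.

(** After a good slot nothing is held, so the newest packet has been received; in a bad slot nothing
    is received and only the clock advances. *)
Lemma trace_age_received a s t :
  trace_age (trace (fun i => (s i, a i)) t)
    = t.+1%:R - (\max_(u <- received a s t.+1) u)%N%:R.
Proof.
elim: t => [|t ih]; first by rewrite /= /received /= big_nil subr0.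
rewrite [LHS]/=; case E : (s t.+1).
  have := source_age_trace a s t.+1; rewrite /= => ->.
  have [_] := freshest_received a s t.+1.
  by rewrite [held _ _ _]/= E => ->.
rewrite received_recr /delivered E /= cats0 ih -[t.+2]addn1 natrD; lra.
Qed.

End deterministic.

(** * Elementary inequalities for second moments *)

Section real_inequalities.
Variable R : realType.

(** The recursion is assumed from index 1 on only, because the first slot follows the arbitrary
    initial law. *)
Lemma affine_recursion_bounded (theta C : R) (x : nat -> R) :
  0 <= theta < 1 -> (forall n, x n.+2 <= theta * x n.+1 + C) ->
  exists B, 0 <= B /\ forall n, x n <= B.
Proof.
move=> /andP[t0 t1] hx.
(* The two initial values plus the fixed point of [x = theta * x + |C|]. *)
pose B := `|x 0%N| + `|x 1%N| + `|C| / (1 - theta).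
have h1 : `|C| / (1 - theta) * (1 - theta) = `|C| 
  by rewrite divfK // gt_eqF // subr_gt0.
have h0 : 0 <= `|C| / (1 - theta) by rewrite divr_ge0 // subr_ge0 ltW.
have [n0 n1] := (normr_ge0 (x 0%N), normr_ge0 (x 1%N)).
have [[l0 l1] lC] := (ler_norm (x 0%N), ler_norm (x 1%N), ler_norm C).
exists B; split; first by rewrite /B; lra.
case; first by rewrite /B; lra.
elim=> [|n ih]; first by rewrite /B; lra.
apply: le_trans (hx n) _.
have h2 : theta * x n.+1 <= theta * B by rewrite ler_wpM2l.
have h3 : 0 <= (`|x 0%N| + `|x 1%N|) * (1 - theta).
  by apply: mulr_ge0; lra.
have h4 : theta * B = B - (`|x 0%N| + `|x 1%N|) * (1 - theta) - `|C|.
  by rewrite -h1 /B; ring.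
lra.
Qed.

(** Completing the square: the difference of the two sides is a nonnegative multiple of a square.
    The factor [(1 + theta) / 2] is still below 1, so growth by one unit is absorbed into a
    contraction. *)
Lemma contract_sqrD1 (theta x : R) : 0 <= theta < 1 ->
  theta * (x + 1) ^+ 2
    <= (1 + theta) / 2 * x ^+ 2 + (theta + 2 * theta ^+ 2 / (1 - theta)).
Proof.
move=> /andP[t0 t1]; have t2 : 0 < 1 - theta by lra.
rewrite -subr_ge0.
rewrite (_ : _ - _ = (1 - theta) / 2 * (x - 2 * theta / (1 - theta)) ^+ 2).
  by rewrite mulr_ge0 ?sqr_ge0 // divr_ge0 ?ltW.
by field; rewrite gt_eqF.
Qed.

Lemma sqr_sum4_le (a b c d : R) :
  (a + b + c + d) ^+ 2 <= 4 * (a ^+ 2 + b ^+ 2 + c ^+ 2 + d ^+ 2).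
Proof.
have := (sqr_ge0 (a - b), sqr_ge0 (a - c), sqr_ge0 (a - d)).
have := (sqr_ge0 (b - c), sqr_ge0 (b - d), sqr_ge0 (c - d)).
by move=> [[h1 h2] h3] [[h4 h5] h6]; nra.
Qed.

Lemma sum_bool_pair (F : bool * bool -> R) : \sum_(x : bool * bool) F x =
  F (true, true) + F (true, false) + (F (false, true) + F (false, false)).
Proof.
transitivity (\sum_(i : bool) \sum_(j : bool) F (i, j)).
  by rewrite pair_bigA; apply: eq_bigr => -[].
by rewrite !big_bool.
Qed.

End real_inequalities.

(** * The transition operator on traces and its iterated expectation *)

Section slot_prob.
Variables (R : realType) (p r lam : R) (mu : bool -> R).
Hypotheses (p_gt0 : 0 < p) (p_lt1 : p < 1) (r_gt0 : 0 < r) (r_lt1 : r < 1).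
Hypotheses (lam_gt0 : 0 < lam) (lam_le1 : lam <= 1).
Hypotheses (mu_ge0 : forall b, 0 <= mu b) (mu_sum : mu true + mu false = 1).

Local Ltac intro_bounds :=
  move: p_gt0 p_lt1 r_gt0 r_lt1 lam_gt0 lam_le1 => p0 p1 r0 r1 lam0 lam1.

(** Conditional law of the next slot given the trace [l]; the first slot takes its channel state
    from the initial law [mu]. *)
Definition slot_prob (l : seq (bool * bool)) (x : bool * bool) : R :=
  (if l is y :: _ then GE_trans p r y.1 x.1 else mu x.1)
  * (if x.2 then lam else 1 - lam).

Definition step (f : seq (bool * bool) -> R) (l : seq (bool * bool)) : R :=
  \sum_(x : bool * bool) slot_prob l x * f (x :: l).

(** Expectation over traces of length [n], by the tower property: the newest slot is integrated out
    first. No probability space is involved yet; [integral_path_trace] makes the link. *)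
Fixpoint expect (n : nat) (f : seq (bool * bool) -> R) : R :=
  if n is n'.+1 then expect n' (step f) else f [::].

Lemma stepE f l : step f l =
  slot_prob l (true, true) * f ((true, true) :: l)
  + slot_prob l (true, false) * f ((true, false) :: l)
  + (slot_prob l (false, true) * f ((false, true) :: l)
  + slot_prob l (false, false) * f ((false, false) :: l)).
Proof.
by rewrite /step sum_bool_pair.
Qed.

Lemma slot_prob_ge0 l x : 0 <= slot_prob l x.
Proof.
intro_bounds.
rewrite /slot_prob mulr_ge0 //; last by case: x.2; lra.
by case: l => // y l; rewrite /GE_trans; case: y.1; case: x.1; lra.
Qed.

Lemma slot_prob_sum1 l : \sum_(x : bool * bool) slot_prob l x = 1.
Proof.
rewrite sum_bool_pair /slot_prob /=.
have hmu : mu false = 1 - mu true by rewrite -mu_sum [mu true + _]addrC addrK.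
by case: l => [|[[] b] l] /=; rewrite ?hmu; ring.
Qed.

Lemma expect_le n (f g : seq (bool * bool) -> R) :
  (forall l, size l = n -> f l <= g l) -> expect n f <= expect n g.
Proof.
elim: n f g => [|n ih] f g fg /=; first exact: fg.
apply: ih => l ln; apply: ler_sum => x _.
by rewrite ler_wpM2l ?slot_prob_ge0 // fg //= ln.
Qed.

Lemma eq_expect n (f g : seq (bool * bool) -> R) :
  (forall l, size l = n -> f l = g l) -> expect n f = expect n g.
Proof.
by move=> fg; apply/le_anti/andP; split; apply: expect_le => l /fg ->.
Qed.

Lemma expectD n (f g : seq (bool * bool) -> R) :
  expect n (fun l => f l + g l) = expect n f + expect n g.
Proof.
elim: n f g => //= n ih f g; rewrite -ih; apply: eq_expect => l _.
by rewrite /step -big_split; apply: eq_bigr => x _; rewrite mulrDr.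
Qed.

Lemma expectZ n (k : R) (f : seq (bool * bool) -> R) :
  expect n (fun l => k * f l) = k * expect n f.
Proof.
elim: n f => //= n ih f; rewrite -ih; apply: eq_expect => l _.
by rewrite /step mulr_sumr; apply: eq_bigr => x _; rewrite mulrCA.
Qed.

Lemma expect_cst n (k : R) : expect n (fun=> k) = k.
Proof.
elim: n => //= n ih; rewrite -[RHS]ih; apply: eq_expect => l _.
by rewrite /step -mulr_suml slot_prob_sum1 mul1r.
Qed.

(** * Bounded second moments of the ages *)

Notation source_age := (@source_age R).
Notation trace_age := (@trace_age R).

(** The source age is reset with probability [lam] and otherwise grows by 1, so its square contracts
    up to a constant. *)
Lemma source_age_sqr_bounded : exists B, 0 <= B /\
  forall n, expect n (fun l => source_age l ^+ 2) <= B.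
Proof.
intro_bounds.
have hth : 0 <= 1 - lam < 1 by apply/andP; split; lra.
pose th := (1 + (1 - lam)) / 2.
apply: (@affine_recursion_bounded _ th
  ((1 - lam) + 2 * (1 - lam) ^+ 2 / (1 - (1 - lam)) + 1)).
  by rewrite /th; apply/andP; split; lra.
move=> n; rewrite [X in _ <= _ + X](esym (expect_cst n.+1 _)) -expectZ -expectD.
rewrite [expect n.+2 _]/(expect n.+1 _); apply: (@expect_le n.+1) => l _.
have h := contract_sqrD1 (source_age l) hth.
have hs : step (fun l => source_age l ^+ 2) l
    = lam + (1 - lam) * (source_age l + 1) ^+ 2.
  rewrite stepE /= /slot_prob /=; case: l {h} => [|[[] b] l] /=; try ring.
  have -> : mu false = 1 - mu true by rewrite -mu_sum [mu true + _]addrC addrK.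
  ring.
rewrite hs /th; move: h; lra.
Qed.

(** From either state the next slot is bad with probability at most [q < 1], and then the age grows
    by 1; in a good slot the age becomes the source age, whose second moment is already bounded. *)
Lemma trace_age_sqr_bounded : exists B, 0 <= B /\
  forall n, expect n (fun l => trace_age l ^+ 2) <= B.
Proof.
intro_bounds.
have [B [B0 hB]] := source_age_sqr_bounded.
pose q := Num.max p (1 - r).
have [q0 q1] : 0 <= q /\ q < 1.
  by rewrite /q le_max gt_max p_lt1 ltW //=; lra.
have hq : 0 <= q < 1 by rewrite q0.
have [pq rq] : p <= q /\ 1 - r <= q by rewrite /q !le_max !lexx orbT.
pose th := (1 + q) / 2; pose C := q + 2 * q ^+ 2 / (1 - q).
apply: (@affine_recursion_bounded _ th (C + B));
  first by rewrite /th; apply/andP; split; lra.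
move=> n.
have : expect n.+2 (fun l => trace_age l ^+ 2) <=
  expect n.+1 (fun l => (th * trace_age l ^+ 2 + C)
     + step (fun l => source_age l ^+ 2) l).
  rewrite [expect n.+2 _]/(expect n.+1 _).
  (* Nonempty traces only: under [mu] the first slot may be bad with probability 1. *)
  apply: (@expect_le n.+1) => -[//|y l] _.
  have h := contract_sqrD1 (trace_age (y :: l)) hq.
  rewrite -/th -/C in h.
  apply: (le_trans _ (lerD h (lexx _))).
  rewrite !stepE /= /slot_prob /=.
  move: (source_age_ge1 R (y :: l)) (trace_age_ge1 R (y :: l)) => /=.
  set u := (if y.2 then _ else _) => hu.
  set v := (if y.1 then _ else _) => hv.
  have hu2 : 0 <= (u + 1) ^+ 2 by exact: sqr_ge0.
  have hv2 : 0 <= (v + 1) ^+ 2 by exact: sqr_ge0.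
  have h1 : p * (v + 1) ^+ 2 <= q * (v + 1) ^+ 2 by rewrite ler_wpM2r.
  have h2 : (1 - r) * (v + 1) ^+ 2 <= q * (v + 1) ^+ 2 by rewrite ler_wpM2r.
  have hlu : 0 <= (1 - lam) * (u + 1) ^+ 2 by rewrite mulr_ge0 //; lra.
  (* The step of the squared source age counts both channel states; [e1] and [e2] allow its bad-slot
     part to be dropped. *)
  have e1 : 0 <= p * (lam + (1 - lam) * (u + 1) ^+ 2).
    by rewrite mulr_ge0 //; lra.
  have e2 : 0 <= (1 - r) * (lam + (1 - lam) * (u + 1) ^+ 2).
    by rewrite mulr_ge0 //; lra.
  by rewrite /GE_trans; case: (y.1); lra.
rewrite 2!expectD expectZ expect_cst.
have h : expect n.+1 (step (fun l => source_age l ^+ 2)) <= B.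
  exact: (hB n.+2).
lra.
Qed.

(* The coefficients solve the Poisson equation
   [corrector - step corrector = trace_age - mean_age] in the span of the age,
   the channel state, the source age, the product of the last two and the
   constants, a space that [step] maps into itself. *)
Definition channel_memory := 1 - p - r.
Definition coef_product :=
  - (channel_memory * lam) / (r * (1 - channel_memory * (1 - lam))).
Definition coef_channel := coef_product * channel_memory / (p + r).
Definition coef_source := (1 - lam) * (1 + coef_product * r) / lam.
Definition mean_age := 1 / lam + p / (r * (p + r)).

Definition channel (l : seq (bool * bool)) : R :=
  if l is x :: _ then x.1%:R else 0.

Definition corrector (l : seq (bool * bool)) : R :=
  trace_age l / r + coef_channel * channel l + coef_source * source_age l
  + coef_product * (channel l * source_age l).

(** For a fixed previous state this is an identity of rational functions. The trace is nonempty so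
    that the next slot follows the transition matrix rather than [mu]. *)
Lemma corrector_Poisson y l :
  step corrector (y :: l) = corrector (y :: l) - trace_age (y :: l) + mean_age.
Proof.
intro_bounds.
rewrite stepE /corrector /slot_prob /GE_trans /=.
set u := (if y.2 then _ else _).
set v := trace_age l + 1.
have [[rn0 pn0] [l0 pr0]] : (r != 0 /\ p != 0) /\ (lam != 0 /\ p + r != 0).
  by rewrite !gt_eqF //; lra.
(* This denominator equals [lam + (p + r) * (1 - lam)]. *)
have d0 : 1 - channel_memory * (1 - lam) != 0.
  have h1 : (p + r) * (1 - lam) >= 0 by rewrite mulr_ge0; lra.
  by rewrite gt_eqF // /channel_memory; lra.
rewrite /mean_age /coef_source /coef_channel /coef_product.
move: d0; rewrite /channel_memory => d0.
by case: (y.1) => /=; field; rewrite l0 pr0 rn0 d0.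
Qed.

Lemma corrector_sqr_bounded : exists B, 0 <= B /\
  forall n, expect n (fun l => corrector l ^+ 2) <= B.
Proof.
have [B1 [B10 hB1]] := source_age_sqr_bounded.
have [B2 [B20 hB2]] := trace_age_sqr_bounded.
(* The channel indicator is at most 1 and the source age at least 1, so three of the four terms are
   bounded through the squared source age. *)
pose K1 := 4 * (coef_channel ^+ 2 + coef_source ^+ 2 + coef_product ^+ 2).
pose K2 := 4 * r^-1 ^+ 2.
have K10 : 0 <= K1 by rewrite /K1 mulr_ge0 // !addr_ge0 ?sqr_ge0.
have K20 : 0 <= K2 by rewrite /K2 mulr_ge0 // ?sqr_ge0.
exists (K1 * B1 + K2 * B2); split; first by apply: addr_ge0; apply: mulr_ge0.
move=> n; have : expect n (fun l => corrector l ^+ 2) <=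
   expect n (fun l => K1 * source_age l ^+ 2 + K2 * trace_age l ^+ 2).
  apply: expect_le => l _; apply: le_trans (sqr_sum4_le _ _ _ _) _.
  have hu := source_age_ge1 R l.
  have [e0 e1] : channel l ^+ 2 = channel l /\ 0 <= channel l <= 1.
    have [-> | ->] : channel l = 0 \/ channel l = 1.
    - by case: l {hu} => [|[[] b] l] /=; [left|right|left].
    - by rewrite expr0n lexx ler01.
    - by rewrite expr1n lexx ler01.
  rewrite (exprMn 2 (trace_age l)) (exprMn 2 coef_channel).
  rewrite (exprMn 2 coef_source) (exprMn 2 coef_product) (exprMn 2 (channel l)).
  rewrite e0 /K1 /K2.
  have hu2 : 1 <= source_age l ^+ 2 by rewrite expr_ge1 //; lra.
  have h1 : coef_channel ^+ 2 * channel l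
      <= coef_channel ^+ 2 * source_age l ^+ 2.
    by rewrite ler_wpM2l ?sqr_ge0 //; lra.
  have h2 : coef_product ^+ 2 * (channel l * source_age l ^+ 2)
      <= coef_product ^+ 2 * source_age l ^+ 2.
    by rewrite ler_wpM2l ?sqr_ge0 // ler_piMl ?sqr_ge0; lra.
  lra.
rewrite expectD !expectZ.
have h1 := ler_wpM2l K10 (hB1 n); have h2 := ler_wpM2l K20 (hB2 n); lra.
Qed.

(** * Martingale decomposition and linear growth of the second moment *)

(** By the Poisson equation, the increment over a nonempty [l'] is
    [corrector l - step corrector l']. The first increment need not be centered. *)
Fixpoint martingale (l : seq (bool * bool)) : R :=
  if l is x :: l' then
    martingale l' + (trace_age l' - mean_age + corrector l - corrector l')
  else 0.

Fixpoint centered_sum (l : seq (bool * bool)) : R :=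
  if l is _ :: l' then centered_sum l' + (trace_age l' - mean_age) else 0.

Lemma centered_sumE l :
  centered_sum l = martingale l - corrector l + corrector [::].
Proof. by elim: l => [|x l /= ->]; [rewrite /=; ring|ring]. Qed.

(** Centered increments are orthogonal to the past, so second moments add up, and each increment has
    a bounded one. *)
Lemma martingale_sqr_bounded : exists B, 0 <= B /\
  forall n, expect n (fun l => martingale l ^+ 2) <= B * n.+1%:R.
Proof.
have [B1 [B10 hB1]] := trace_age_sqr_bounded.
have [B2 [B20 hB2]] := corrector_sqr_bounded.
pose incr l x := trace_age l - mean_age + corrector (x :: l) - corrector l.
have key n : expect n.+2 (fun l => martingale l ^+ 2) <=
    expect n.+1 (fun l => martingale l ^+ 2)
    + 4 * (B1 + mean_age ^+ 2 + B2 + B2).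
  have : expect n.+2 (fun l => martingale l ^+ 2) <=
    expect n.+1 (fun l => martingale l ^+ 2 +
      4 * (trace_age l ^+ 2 + mean_age ^+ 2 + step (fun l => corrector l ^+ 2) l
           + corrector l ^+ 2)).
    rewrite [expect n.+2 _]/(expect n.+1 _).
    apply: (@expect_le n.+1) => -[//|y l'] _.
    move: (y :: l') (corrector_Poisson y l') => l step_l.
    have e0 : \sum_(x : bool * bool) slot_prob l x * incr l x = 0.
      transitivity (step corrector l + (trace_age l - mean_age - corrector l)
                      * \sum_(x : bool * bool) slot_prob l x).
        rewrite mulr_sumr /step -big_split; apply: eq_bigr => x _ /=.
        by rewrite /incr; ring.
      by rewrite slot_prob_sum1 step_l; ring.
    (* Expanding the square, the cross term vanishes by [e0]. *)
    have -> : step (fun l => martingale l ^+ 2) l = martingale l ^+ 2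
        + \sum_(x : bool * bool) slot_prob l x * incr l x ^+ 2.
      transitivity (martingale l ^+ 2 * \sum_(x : bool * bool) slot_prob l x
         + (2 * martingale l)
           * (\sum_(x : bool * bool) slot_prob l x * incr l x)
         + \sum_(x : bool * bool) slot_prob l x * incr l x ^+ 2).
        rewrite 2!mulr_sumr /step -!big_split; apply: eq_bigr => x _ /=.
        by rewrite -/(incr l x); ring.
      by rewrite e0 slot_prob_sum1; ring.
    rewrite lerD2l.
    have -> : 4 * (trace_age l ^+ 2 + mean_age ^+ 2
          + step (fun l => corrector l ^+ 2) l + corrector l ^+ 2)
      = \sum_(x : bool * bool) slot_prob l x * (4 * (trace_age l ^+ 2
          + (- mean_age) ^+ 2 + corrector (x :: l) ^+ 2
          + (- corrector l) ^+ 2)).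
      transitivity (4 * step (fun l => corrector l ^+ 2) l
          + 4 * (trace_age l ^+ 2 + mean_age ^+ 2 + corrector l ^+ 2)
            * \sum_(x : bool * bool) slot_prob l x).
        by rewrite slot_prob_sum1; ring.
      rewrite !mulr_sumr -big_split; apply: eq_bigr => x _ /=.
      by rewrite !sqrrN; ring.
    by apply: ler_sum => x _; rewrite ler_wpM2l ?slot_prob_ge0 // sqr_sum4_le.
  rewrite expectD expectZ 3!expectD expect_cst.
  have h : expect n.+1 (step (fun l => corrector l ^+ 2)) <= B2.
    exact: (hB2 n.+2).
  have := hB1 n.+1; have := hB2 n.+1; lra.
set K := 4 * _ in key.
have K0 : 0 <= K by rewrite mulr_ge0 // !addr_ge0 ?sqr_ge0.
(* The second moment after one slot is taken as it is, since the induction step [key] starts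
   there. *)
pose B := `|expect 1 (fun l => martingale l ^+ 2)| + K.
exists B; split; first by rewrite addr_ge0.
have B0 : 0 <= B by rewrite addr_ge0.
case=> [|n]; first by rewrite [expect _ _]/= expr0n mulr_ge0.
have hK : K <= B by rewrite lerDr.
elim: n => [|n ih].
  rewrite mulr_natr mulr2n; apply: le_trans (ler_norm _) _.
  by apply: (@le_trans _ _ B); rewrite /B ?lerDl.
apply: le_trans (key n) _; rewrite -[n.+3]addn1 natrD; lra.
Qed.

Lemma centered_sum_sqr_bounded : exists B, 0 <= B /\
  forall n, expect n (fun l => centered_sum l ^+ 2) <= B * n.+1%:R.
Proof.
have [B1 [B10 hB1]] := martingale_sqr_bounded.
have [B2 [B20 hB2]] := corrector_sqr_bounded.
pose k := corrector [::] ^+ 2.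
have k0 : 0 <= k by exact: sqr_ge0.
exists (4 * (B1 + B2 + k)); split; first by rewrite mulr_ge0 // !addr_ge0.
move=> n; have : expect n (fun l => centered_sum l ^+ 2) <=
    expect n (fun l => 4 * (martingale l ^+ 2 + corrector l ^+ 2 + k)).
  apply: expect_le => l _; rewrite centered_sumE.
  have := sqr_sum4_le (martingale l) (- corrector l) (corrector [::]) 0.
  by rewrite sqrrN addr0 expr0n addr0.
rewrite expectZ !expectD expect_cst; have := hB1 n; have := hB2 n.
have h1 : 0 <= B2 * n%:R by rewrite mulr_ge0.
have h2 : 0 <= k * n%:R by rewrite mulr_ge0.
by rewrite -[n.+1]addn1 natrD; lra.
Qed.

End slot_prob.

(** * From averages along squares to the time average of the age *)

Section averages.
Variable R : realType.

Lemma square_interval (n : nat) :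
  exists j : nat, (0 < n)%N -> (j.+1 ^ 2 <= n < j.+2 ^ 2)%N.
Proof.
elim: n => [|[|n] [j ih]]; [by exists 0%N|by exists 0%N|].
have /andP[h1 h2] := ih isT.
have [h|h] := ltnP n.+2 (j.+2 ^ 2)%N; [exists j|exists j.+1] => _.
  by rewrite h (leq_trans h1).
by rewrite h (leq_ltn_trans h2) // ltn_sqr.
Qed.

(** Partial sums of nonnegative terms are monotone, so the average at [n] lies between those at the
    neighbouring squares, up to ratios of consecutive squares, which tend to 1. *)
Lemma average_of_squares (x : nat -> R) (m : R) :
  (forall i, 0 <= x i) ->
  ((k.+1 ^ 2)%:R^-1 * \sum_(0 <= i < k.+1 ^ 2) x i) @[k --> \oo] --> m ->
  (n%:R^-1 * \sum_(0 <= i < n) x i) @[n --> \oo] --> m.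
Proof.
move=> x0; set y := fun k : nat => _ => ym.
have [j hj] := choice square_interval.
have jcvg : j n @[n --> \oo] --> \oo.
  apply/cvgnyPge => K; exists (K.+2 ^ 2)%N => // n /= Kn.
  have /hj/andP[_ h] : (0 < n)%N by apply: leq_trans Kn; rewrite expn_gt0.
  have := leq_ltn_trans Kn h; rewrite ltn_sqr !ltnS; exact: ltnW.
(* The squared factors are [((k+1)/(k+2))^2] in [L] and [((k+2)/(k+1))^2] in [U]: they exchange the
   denominators of the two neighbouring squares. *)
pose L k := y k * (1 - harmonic k.+1) ^+ 2.
pose U k := y k.+1 * (1 + harmonic k) ^+ 2.
have Lm : L k @[k --> \oo] --> m.
  rewrite -[m]mulr1 -(expr1n _ 2) -[1]subr0.
  apply: cvgM => //; apply: cvgM; (apply: cvgB; first exact: cvg_cst);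
    by rewrite (cvg_shiftS (@harmonic R)); exact: cvg_harmonic.
have Um : U k @[k --> \oo] --> m.
  rewrite -[m]mulr1 -(expr1n _ 2) -[1]addr0.
  apply: cvgM; first by rewrite (cvg_shiftS y).
  by apply: cvgM; (apply: cvgD; first exact: cvg_cst); exact: cvg_harmonic.
have nd (a b : nat) : (a <= b)%N ->
    \sum_(0 <= i < a) x i <= \sum_(0 <= i < b) x i.
  move=> ab; rewrite [leRHS](@big_cat_nat _ _ _ a) //= lerDl.
  by apply: sumr_ge0 => i _; exact: x0.
have pos (a : nat) : 0 <= \sum_(0 <= i < a) x i by apply: sumr_ge0 => i _.
apply: (@squeeze_cvgr _ _ _ _ (L \o j) (U \o j)); last 2 first.
- exact: (cvg_comp _ _ jcvg Lm).
- exact: (cvg_comp _ _ jcvg Um).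
exists 1%N => // n /= n1; have /andP[h1 h2] := hj n n1.
have nR : 0 < (n%:R : R) by rewrite ltr0n.
have e1 : L (j n) = ((j n).+2 ^ 2)%:R^-1 * \sum_(0 <= i < (j n).+1 ^ 2) x i.
  rewrite /L /y /harmonic /= !natrX -[(j n).+2]addn1 -[(j n).+1]addn1 !natrD.
  have : 0 <= ((j n)%:R : R) by [].
  move: (\sum_(_ <= _ < _) _) ((j n)%:R) => s q q0; field.
  by rewrite !gt_eqF //; lra.
have e2 : U (j n) = ((j n).+1 ^ 2)%:R^-1 * \sum_(0 <= i < (j n).+2 ^ 2) x i.
  rewrite /U /y /harmonic /= !natrX -[(j n).+2]addn1 -[(j n).+1]addn1 !natrD.
  have : 0 <= ((j n)%:R : R) by [].
  move: (\sum_(_ <= _ < _) _) ((j n)%:R) => s q q0; field.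
  by rewrite !gt_eqF //; lra.
rewrite e1 e2; apply/andP; split; apply: ler_pM; rewrite ?invr_ge0 ?nd //.
- by rewrite lef_pV2 ?posrE ?ltr0n ?expn_gt0 // ler_nat ltnW.
- by rewrite lef_pV2 ?posrE ?ltr0n ?expn_gt0 // ler_nat.
by rewrite ltnW.
Qed.

Lemma average_eventually_eq (x y : nat -> R) (m : R) :
  (\forall i \near \oo, x i = y i) ->
  (n%:R^-1 * \sum_(0 <= i < n) y i) @[n --> \oo] --> m ->
  (n%:R^-1 * \sum_(0 <= i < n) x i) @[n --> \oo] --> m.
Proof.
move=> [N _ xy] ym.
pose C := \sum_(0 <= i < N) (x i - y i).
have inv0 : (n%:R^-1 : R) @[n --> \oo] --> 0.
  by rewrite -(cvg_shiftS (fun n : nat => n%:R^-1 : R)); exact: cvg_harmonic.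
have C0 : (n%:R^-1 * C) @[n --> \oo] --> 0.
  by rewrite -(mul0r C); apply: (cvgM inv0); exact: cvg_cst.
have h : (n%:R^-1 * C + n%:R^-1 * \sum_(0 <= i < n) y i) @[n --> \oo] --> m.
  by rewrite -[m]add0r; exact: (cvgD C0 ym).
apply: cvg_trans h; apply: near_eq_cvg; exists N => // n /= Nn.
rewrite -mulrDr; congr (_ * _); apply/eqP.
rewrite eq_sym -subr_eq -sumrB (@big_cat_nat _ _ _ N) //= -/C.
rewrite [X in _ + X]big_nat_cond big1 ?addr0 // => i /andP[/andP[Ni _] _].
by rewrite (xy i Ni) subrr.
Qed.

Lemma trace_age_ge0 l : 0 <= trace_age R l.
Proof. exact: le_trans ler01 (trace_age_ge1 R l). Qed.

(** Without any delivery the age would grow linearly and its averages [(n + 1) / 2] would diverge.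
    Convergence thus yields a first delivery with no separate probabilistic argument. *)
Lemma delivery_of_average (a s : nat -> bool) (m : R) :
  (n%:R^-1 * \sum_(0 <= i < n) trace_age R (trace (fun t => (s t, a t)) i))
    @[n --> \oo] --> m ->
  exists t, received a s t.+1 != [::].
Proof.
move=> h; apply/not_existsP => hnil.
have nil t : received a s t.+1 = [::] by apply/eqP/negPn/negP/hnil.
have e n : \sum_(0 <= i < n) trace_age R (trace (fun t => (s t, a t)) i)
    = n%:R * n.+1%:R / 2.
  elim: n => [|n ih]; first by rewrite big_nil !mul0r.
  rewrite big_nat_recr //= ih trace_age_received nil big_nil subr0.
  rewrite -[n.+2]addn1 -[n.+1]addn1 !natrD; lra.
have /cvgrPdist_lt/(_ 1 ltr01)[N _ hN] := h.
have [M _ hM] := nbhs_infty_gtr (2 * (m + 1)).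
pose n := maxn N.+1 M.
have := hN n (leq_trans (leqnSn N) (leq_maxl _ _)) ; rewrite /= e.
have := hM n (leq_maxr _ _) => /= h1.
have n0 : n%:R != 0 :> R.
  by rewrite pnatr_eq0 -lt0n (leq_trans _ (leq_maxl _ _)).
rewrite !mulrA mulVf // mul1r ltr_norml => /andP[h2 _].
move: h2; rewrite -[n.+1]addn1 natrD; lra.
Qed.

Lemma age_average (a s : nat -> bool) (dflt : nat -> R) (m : R) :
  ((k.+1 ^ 2)%:R^-1 * \sum_(0 <= i < k.+1 ^ 2)
      trace_age R (trace (fun t => (s t, a t)) i)) @[k --> \oo] --> m ->
  time_average (age a s dflt) tau @[tau --> \oo] --> m.
Proof.
move=> /average_of_squares -/(_ (fun=> trace_age_ge0 _)) h.
have [t0 ht0] := delivery_of_average h.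
have -> : time_average (age a s dflt) =
    fun n : nat => n%:R^-1 * \sum_(0 <= i < n) age a s dflt i.+1.
  by apply/funext => n; rewrite /time_average big_add1.
apply: average_eventually_eq h; exists t0 => // t /= t0t.
rewrite trace_age_received /age.
suff : received a s t.+1 != [::] by case: (received a s t.+1).
rewrite -(subnKC t0t); elim: (t - t0)%N => [|i ih]; first by rewrite addn0.
by rewrite addnS received_recr; case: (received a s _) ih.
Qed.

End averages.

(** * Traces as finite words *)

Lemma eq_trace (c c' : nat -> bool * bool) n :
  trace c n = trace c' n <-> forall t, (0 < t <= n)%N -> c t = c' t.
Proof.
elim: n => [|n [ih1 ih2]] /=.
  by split => // _ t /andP[t0]; rewrite leqNgt t0.
split=> [[h1 h2] t /andP[t0]|h].
  rewrite leq_eqVlt ltnS => /predU1P[->//|tn].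
  by apply: ih1 => //; rewrite t0.
rewrite h ?leqnn // ih2 // => t /andP[t0 tn]; rewrite h // t0.
exact: leqW.
Qed.

Lemma trace_onto (l : seq (bool * bool)) :
  exists c : nat -> bool * bool, trace c (size l) = l.
Proof.
elim: l => [|x l [c hc]]; first by exists (fun=> (true, true)).
exists (fun t => if t == (size l).+1 then x else c t) => /=.
rewrite eqxx -[in RHS]hc; congr cons; apply/eq_trace => t /andP[_ tl].
by rewrite ltn_eqF.
Qed.

Lemma size_trace c n : size (trace c n) = n.
Proof. by elim: n => //= n ->. Qed.

Fixpoint words (n : nat) : seq (seq (bool * bool)) :=
  if n is n'.+1 then
    [seq x :: l | l <- words n', x <- enum (predT : pred (bool * bool))]
  else [:: [::]].

Lemma mem_words n l : (l \in words n) = (size l == n).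
Proof.
elim: n l => [|n ih] l; first by rewrite inE; case: l.
apply/allpairsP/eqP => [[[l' x] /= [+ _ ->]]|].
  by rewrite ih => /eqP <-.
case: l => // x l [ln]; exists (l, x) => /=.
by rewrite ih ln eqxx mem_enum.
Qed.

Lemma words_uniq n : uniq (words n).
Proof.
elim: n => //= n ih; apply: allpairs_uniq => //; first exact: enum_uniq.
by move=> [l x] [l' x'] _ _ /= [-> ->].
Qed.

(** * The law of the trace on the probability space *)

Section law.
Context {R : realType} {d : measure_display} {T : measurableType d}.
Variables (P : probability T R) (p r lam : R).
Variables (S A : nat -> {RV P >-> bool}).
Hypotheses (hS : GE_channel p r S) (hA : bernoulli_arrivals lam A).
Hypothesis hAS : independent_processes A S.

Definition channel_init (b : bool) : R := fine (P (S 1 @^-1` [set b])).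

Definition path_trace (n : nat) (w : T) : seq (bool * bool) :=
  trace (fun t => (S t w, A t w)) n.

Notation slot_prob := (slot_prob p r lam channel_init).
Notation expect := (expect p r lam channel_init).

Lemma measurable_RV_preimage (X : {RV P >-> bool}) (B : set bool) :
  measurable (X @^-1` B).
Proof. exact: measurable_funPTI. Qed.

Lemma RV_bool_false (X : {RV P >-> bool}) :
  P (X @^-1` [set false]) = (1 - P (X @^-1` [set true]))%E.
Proof.
rewrite -probability_setC; last exact: measurable_RV_preimage.
by congr (P _); apply/seteqP; split => w /=; case: (X w).
Qed.

Lemma channel_init_ge0 b : 0 <= channel_init b.
Proof. exact: fine_ge0. Qed.

Lemma channel_init_sum : channel_init true + channel_init false = 1.
Proof.
rewrite /channel_init RV_bool_false fineB ?fin_num_measure //; last first.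
  exact: measurable_RV_preimage.
by rewrite /= addrC subrK.
Qed.

Lemma sigma_process_bigcap (X : nat -> {RV P >-> bool}) (B : nat -> set bool)
    n :
  sigma_process X (\bigcap_(t in [set` iota 1 n]) X t @^-1` B t).
Proof.
pose G := \bigcup_(t in [set t | (0 < t)%N]) g_sigma_algebra_preimage (X t).
apply: (@fin_bigcap_measurable _ (g_sigma_algebraType G)).
  exact: finite_seq.
move=> t /=; rewrite mem_iota => /andP[t0 _]; apply: sub_sigma_algebra.
by exists t => //; exists (B t) => //; rewrite setTI.
Qed.

Lemma historyE (X : nat -> {RV P >-> bool}) (c : nat -> bool) n :
  history X c n = \bigcap_(t in [set` iota 1 n]) X t @^-1` [set c t].
Proof.
apply/seteqP; split => w /= h t; have := h t; rewrite /= ?mem_iota add1n ltnS;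
  exact.
Qed.

Lemma history0 (X : nat -> {RV P >-> bool}) (c : nat -> bool) :
  history X c 0 = setT.
Proof.
by apply/seteqP; split => // w _ t /andP[t0]; rewrite leqNgt t0.
Qed.

Lemma measurable_history (X : nat -> {RV P >-> bool}) (c : nat -> bool) n :
  measurable (history X c n).
Proof.
rewrite historyE; apply: fin_bigcap_measurable; first exact: finite_seq.
by move=> t _; exact: measurable_RV_preimage.
Qed.

Lemma historyS (X : nat -> {RV P >-> bool}) (c : nat -> bool) n :
  history X c n.+1 = X n.+1 @^-1` [set c n.+1] `&` history X c n.
Proof.
apply/seteqP; split => [w h|w [h1 h2] t /andP[t0]].
  split => [|t /andP[t0 tn]]; first by apply: h; rewrite leqnn.
  by apply: h; rewrite t0 leqW.
rewrite leq_eqVlt ltnS => /predU1P[->//|tn].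
by apply: h2; rewrite t0.
Qed.

Lemma prob_arrivals (c : nat -> bool) n :
  P (history A c n) = (\prod_(t <- iota 1 n) (if c t then lam else 1 - lam))%:E.
Proof.
rewrite historyE hA.2 ?iota_uniq //; last first.
  by apply/allP => t; rewrite mem_iota => /andP[].
rewrite -prodEFin; apply: eq_big_seq => t; rewrite mem_iota => /andP[t0 _].
by case: (c t); rewrite ?RV_bool_false hA.1.
Qed.

Lemma prob_channel (c : nat -> bool) n :
  fine (P (history S c n.+1)) = fine (P (history S c n))
    * (if n is 0 then channel_init (c 1%N) else GE_trans p r (c n) (c n.+1)).
Proof.
have mS k := measurable_history S c k.
case: n => [|n].
  by rewrite historyS !history0 probability_setT mul1r setIT.
(* A null history leaves the conditional probability unconstrained, but then both sides are 0. *)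
have [h0|h0] := eqVneq (P (history S c n.+1)) 0%E.
  rewrite h0 mul0r; suff -> : P (history S c n.+2) = 0%E by [].
  apply/eqP; rewrite eq_le measure_ge0 andbT -h0 le_measure ?inE //.
  by rewrite historyS; exact: subIsetr.
rewrite -(hS (ltn0Sn n) h0) /cond_prob -historyS mulrC divfK //.
by rewrite fine_eq0 // fin_num_measure.
Qed.

Lemma path_trace_event c n : [set w | path_trace n w = trace c n] =
  history A (fun t => (c t).2) n `&` history S (fun t => (c t).1) n.
Proof.
apply/seteqP; split=> w /=.
  by move=> /eq_trace h; split => t /h <-.
by move=> [h1 h2]; apply/eq_trace => t tn; rewrite h1 // h2 //; case: (c t).
Qed.

Fixpoint weight (l : seq (bool * bool)) : R :=
  if l is x :: l' then weight l' * slot_prob l' x else 1.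

(** Independence separates arrivals from channel states; the product rule for the former and the
    chain rule for the latter regroup slot by slot into [weight]. *)
Lemma prob_path_trace n l : size l = n ->
  P [set w | path_trace n w = l] = (weight l)%:E.
Proof.
have [c <-] := trace_onto l; rewrite size_trace => ->.
rewrite path_trace_event.
rewrite hAS; try by rewrite historyE; exact: sigma_process_bigcap.
rewrite prob_arrivals -(@fineK _ (P (history S _ _))); last first.
  by rewrite fin_num_measure //; exact: measurable_history.
rewrite -EFinM; congr EFin; elim: n => [|n ih].
  by rewrite big_nil mul1r history0 probability_setT.
rewrite prob_channel -[n.+1]addn1 iotaD big_cat big_seq1 /= add1n addn1 /= -ih.
rewrite /slot_prob; case: n {ih} => [|n] /=; ring.
Qed.

Lemma expectE n f : expect n f = \sum_(l <- words n) weight l * f l.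
Proof.
elim: n f => [|n ih] f /=; first by rewrite big_seq1 mul1r.
rewrite ih big_allpairs_dep; apply: eq_bigr => l _.
rewrite /step big_enum mulr_sumr; apply: eq_bigr => x _ /=.
by rewrite mulrA.
Qed.

Lemma measurable_path_trace n l : measurable [set w | path_trace n w = l].
Proof.
have [<-|ln] := eqVneq (size l) n; last first.
  rewrite [X in measurable X](_ : _ = set0) //.
  apply/seteqP; split => // w /= e.
  by move/eqP: ln; apply; rewrite -e size_trace.
have [c e] := trace_onto l.
rewrite -e size_trace path_trace_event.
by apply: measurableI; exact: measurable_history.
Qed.

(** Only finitely many traces of length [n] exist, so any function of the trace is a simple
    function; measurability and integrals follow. *)
Lemma path_trace_indic n (f : seq (bool * bool) -> R) w :
  (f (path_trace n w))%:E =
  (\sum_(l <- words n) (f l)%:E * (\1_[set w | path_trace n w = l] w)%:E)%E.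
Proof.
have hw : path_trace n w \in words n by rewrite mem_words size_trace.
rewrite (bigD1_seq _ hw) ?words_uniq //= big1 => [|l ln].
  by rewrite indicE mem_set // mule1 adde0.
by rewrite indicE memNset ?mule0 //= => e; rewrite e eqxx in ln.
Qed.

Lemma measurable_fun_path_trace n (f : seq (bool * bool) -> R) :
  measurable_fun [set: T] ((fun w => (f (path_trace n w))%:E)).
Proof.
under eq_fun do rewrite path_trace_indic.
apply: emeasurable_sum => l; apply: measurable_funeM.
apply/measurable_EFinP; apply: measurable_indic; exact: measurable_path_trace.
Qed.

Lemma integral_path_trace n (f : seq (bool * bool) -> R) :
  (forall l, 0 <= f l) ->
  (\int[P]_w (f (path_trace n w))%:E = (expect n f)%:E)%E.
Proof.
move=> f0; under eq_integral do rewrite path_trace_indic.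
have mi l : measurable_fun [set: T]
    ((fun w => (\1_[set w | path_trace n w = l] w)%:E)).
  apply/measurable_EFinP; apply: measurable_indic; exact: measurable_path_trace.
rewrite ge0_integral_sum //; last 2 first.
- by move=> l; exact: measurable_funeM.
- by move=> l w _; rewrite mule_ge0 // lee_fin.
rewrite expectE -sumEFin; apply: eq_big_seq => l; rewrite mem_words => /eqP ln.
rewrite ge0_integralZl ?lee_fin //.
rewrite integral_indic ?setIT //; last exact: measurable_path_trace.
by rewrite [X in (_ * X)%E](prob_path_trace ln) -EFinM mulrC.
Qed.

End law.

(** * Almost sure convergence *)

Lemma centered_sum_trace (R : realType) (p r lam : R) c n :
  centered_sum p r lam (trace c n)
    = \sum_(0 <= i < n) trace_age R (trace c i) - n%:R * mean_age p r lam.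
Proof.
elim: n => [|n /= ->]; first by rewrite big_nil mul0r subrr.
by rewrite big_nat_recr //= -[n.+1]addn1 natrD; ring.
Qed.

Lemma sum_inv_squares_le (R : realType) m :
  \sum_(0 <= k < m) ((k.+1 ^ 2)%:R^-1 : R) <= 2.
Proof.
(* The sharper bound [2 - 1/(m+1)] is what carries the induction. *)
suff h : \sum_(0 <= k < m.+1) ((k.+1 ^ 2)%:R^-1 : R) <= 2 - m.+1%:R^-1.
  apply: (le_trans _ (le_trans h _)).
    by rewrite [leRHS]big_nat_recr //= lerDl invr_ge0.
  by rewrite gerBl invr_ge0.
elim: m => [|m ih]; first by rewrite big_nat1 exp1n invr1; lra.
rewrite big_nat_recr //= -lerBrDr; apply: le_trans ih _.
rewrite natrX -[m.+2]addn1 natrD.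
have : 0 < (m.+1%:R : R) by rewrite ltr0n.
move: (m.+1%:R : R) => x x0; rewrite -subr_ge0.
rewrite (_ : _ - _ = (x * (x + 1) ^+ 2)^-1).
  by rewrite invr_ge0 mulr_ge0 ?sqr_ge0 // ltW.
by field; rewrite !gt_eqF //; lra.
Qed.

Lemma cvg0_sqr (R : realType) (x : nat -> R) :
  (x n ^+ 2) @[n --> \oo] --> 0 -> x n @[n --> \oo] --> 0.
Proof.
move=> /cvgrPdist_lt h; apply/cvgrPdist_lt => e e0.
have /h : 0 < e ^+ 2 by rewrite exprn_gt0.
apply: filterS => n; rewrite !sub0r !normrN normrX.
by rewrite ltr_pXn2r // nnegrE ?normr_ge0 // ltW.
Qed.

(** By monotone convergence the series of squares has a finite integral, so it is finite almost
    everywhere and its terms tend to 0. *)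
Lemma ae_cvg0_of_sqr_summable (R : realType) (d : measure_display)
    (T : measurableType d) (P : probability T R) (X : nat -> T -> R) (C : R) :
  (forall k, measurable_fun [set: T] (fun w => (X k w ^+ 2)%:E)) ->
  (forall k, (\int[P]_w (X k w ^+ 2)%:E <= (C * (k.+1 ^ 2)%:R^-1)%:E)%E) ->
  {ae P, forall w, X k w @[k --> \oo] --> 0}.
Proof.
move=> mX hX.
have C0 : 0 <= C.
  have i0 : (0 <= \int[P]_w (X 0%N w ^+ 2)%:E)%E.
    by apply: integral_ge0 => w _; rewrite lee_fin sqr_ge0.
  by have := le_trans i0 (hX 0%N); rewrite lee_fin exp1n invr1 mulr1.
have X0 k w : [set: T] w -> (0 <= (X k w ^+ 2)%:E)%E by rewrite lee_fin sqr_ge0.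
pose Y w := (\sum_(0 <= k <oo) (X k w ^+ 2)%:E)%E.
have Y0 w : (0 <= Y w)%E by apply: nneseries_ge0 => k _ _; exact: X0.
have iY : P.-integrable [set: T] Y.
  apply/integrableP; split.
    by apply: ge0_emeasurable_sum => [k w _ _|k _]; [exact: X0|exact: mX].
  under eq_integral do rewrite gee0_abs //.
  rewrite integral_nneseries //; apply: (@le_lt_trans _ _ (C * 2)%:E);
    last exact: ltry.
  apply: lime_le.
    by apply: is_cvg_nneseries => k _ _; apply: integral_ge0 => w _; exact: X0.
  apply: nearW => m; apply: (@le_trans _ _
    (\sum_(0 <= k < m) (C * (k.+1 ^ 2)%:R^-1)%:E)%E); first exact: lee_sum.
  by rewrite sumEFin lee_fin -mulr_sumr ler_wpM2l // sum_inv_squares_le.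
have := integrable_ae measurableT iY; apply: filterS => w /(_ I) fY.
apply: cvg0_sqr; apply: cvg_series_cvg_0; apply: nnseries_is_cvg => [k|].
  exact: sqr_ge0.
by rewrite ltey_eq fY.
Qed.

Theorem lemma1 (R : realType) (d : measure_display) (T : measurableType d)
    (P : probability T R) (p r lam : R)
    (S A : nat -> {RV P >-> bool}) (dflt : nat -> R)
    (hp : 0 < p < 1) (hr : 0 < r < 1) (hlam : 0 < lam <= 1)
    (hS : GE_channel p r S)
    (hA : bernoulli_arrivals lam A)
    (hAS : independent_processes A S) :
  {ae P, forall w : T,
    time_average (age (fun t => A t w) (fun t => S t w) dflt) tau @[tau --> \oo]
      --> 1 / lam + p / (r * (p + r))}.
Proof.
move: (hp) (hr) (hlam) => /andP[p0 p1] /andP[r0 r1] /andP[lam0 lam1].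
have [B [B0 hB]] := centered_sum_sqr_bounded p0 p1 r0 r1 lam0 lam1
  (channel_init_ge0 S) (channel_init_sum S).
pose n k := (k.+1 ^ 2)%N.
pose f k l := ((n k)%:R^-1 * centered_sum p r lam l) ^+ 2.
have : {ae P, forall w,
    (n k)%:R^-1 * centered_sum p r lam (path_trace S A (n k) w)
    @[k --> \oo] --> 0}.
  (* With [N = (k+1)^2] the second moment is at most [B (N + 1) / N^2], hence at most [2 B / N]. *)
  apply: (@ae_cvg0_of_sqr_summable _ _ _ _ _ (B * 2)) => k.
    exact: (measurable_fun_path_trace S A (n k) (f k)).
  have := @integral_path_trace _ _ _ _ _ _ _ _ _ hS hA hAS (n k) (f k)
    (fun=> sqr_ge0 _).
  rewrite /f => ->; rewrite lee_fin.
  under [X in expect _ _ _ _ _ X]eq_fun do rewrite exprMn.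
  rewrite expectZ //; last exact: channel_init_ge0.
  have nk : 1 <= (n k)%:R :> R by rewrite ler1n /n expn_gt0.
  apply: le_trans (ler_wpM2l (sqr_ge0 _) (hB (n k))) _.
  rewrite -/(n k) -[(n k).+1]addn1 natrD -subr_ge0.
  move: ((n k)%:R : R) nk => x x1.
  rewrite (_ : _ - _ = B * (x - 1) / x ^+ 2).
    by rewrite divr_ge0 ?sqr_ge0 // mulr_ge0 // subr_ge0.
  by field; rewrite gt_eqF //; lra.
apply: filterS => w hw; apply: age_average.
rewrite -[_ + _]/(mean_age p r lam) -[mean_age _ _ _]add0r.
(* The average of the ages is the normalized centered sum plus its mean. *)
rewrite [X in X @ _ --> _](_ : _ = fun k =>
  (n k)%:R^-1 * centered_sum p r lam (path_trace S A (n k) w)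
  + mean_age p r lam).
  by apply: cvgD hw _; exact: cvg_cst.
apply/funext => k; rewrite /path_trace centered_sum_trace mulrBr mulrA.
rewrite mulVf ?mul1r ?subrK //.
by rewrite pnatr_eq0 -lt0n expn_gt0.
Qed.
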